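(* Let $G=(V,E)$ be a graph with an odd number of vertices. Then $G$ is an $n$-convex geometry if and only if the following conditions both hold: (1) $G$ contains a unique star vertex $s$; (2) $G-\{s\}$ (the subgraph of $G$ induced by $V\setminus\{s\}$) is an $n$-convex geometry.
   Context: All graphs are finite, simple and undirected, with non-empty vertex set. For a graph $G=(V,E)$ and $x\in V$, the closed neighbourhood of $x$ is $N[x]=\{x\}\cup\{y\in V:\{x,y\}\in E\}$. A star (or star vertex) of $G$ is a vertex $s$ with $N[s]=V$. For $Y\subseteq V$, the common closed neighbourhood is $N[Y]=\bigcap_{y\in Y}N[y]$ if $Y\neq\varnothing$, and $N[\varnothing]=V$. The neighbourhood convexity of $G$ is the family $n_G=\{N[Y]:Y\subseteq V\}\cup\{\varnothing\}$ of subsets of $V$; it contains $\varnothing$ and $V$ and is closed under intersection. Its members are called $n$-convex sets. For $X\subseteq V$ the convex hull $[X]_{n}$ is the intersection of all $n$-convex sets containing $X$. For an $n$-convex set $K$, $\operatorname{ex}(K)=\{x\in K: K\setminus\{x\}\in n_G\}$ is the set of extreme points of $K$. $G$ is an $n$-convex geometry if $K=[\operatorname{ex}(K)]_{n}$ for every $n$-convex set $K$. *)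

(* Defs.v *)
(* Finite simple graphs and their neighbourhood convexity (MathComp). *)
From HB Require Import structures.
From mathcomp Require Import all_boot.

Set Implicit Arguments.
Unset Strict Implicit.
Unset Printing Implicit Defensive.

(* The vertex type may be empty, so that deleting the only vertex of a
   one-vertex graph is meaningful. *)
Record sgraph := SGraph {
  vertex :> finType;
  edge : rel vertex;
  edge_sym : symmetric edge;
  edge_irrefl : irreflexive edge }.

Section InducedSubgraph.
Variables (G : sgraph) (A : {set G}).

Definition induced_edge : rel {x : G | x \in A} :=
  [rel x y | edge (val x) (val y)].

Lemma induced_edge_sym : symmetric induced_edge.
Proof. by move=> x y; apply: edge_sym. Qed.

Lemma induced_edge_irrefl : irreflexive induced_edge.
Proof. by move=> x; apply: edge_irrefl. Qed.

Definition induced : sgraph := SGraph induced_edge_sym induced_edge_irrefl.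
End InducedSubgraph.

Definition del_vertex (G : sgraph) (s : G) : sgraph := induced [set~ s].

Section NeighbourhoodConvexity.
Variable G : sgraph.

Definition cnbh (x : G) : {set G} := x |: [set y | edge x y].

Definition star (s : G) : Prop := cnbh s = [set: G].

(* For Y = set0 the empty intersection is the whole vertex set. *)
Definition common_cnbh (Y : {set G}) : {set G} := \bigcap_(y in Y) cnbh y.

Definition nconvex : {set {set G}} :=
  set0 |: [set common_cnbh Y | Y : {set G}].

Definition nhull (X : {set G}) : {set G} :=
  \bigcap_(K in nconvex | X \subset K) K.

Definition extreme (K : {set G}) : {set G} :=
  [set x in K | K :\ x \in nconvex].

Definition n_convex_geometry : Prop :=
  forall K : {set G}, K \in nconvex -> K = nhull (extreme K).
End NeighbourhoodConvexity.

(* Main.v *)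
Require Import Defs.
From mathcomp Require Import all_boot.

(** Write N for [common_cnbh]. In an n-convex geometry, comparable convex sets
    are joined by chains of convex sets growing one vertex at a time. If there
    is no star, N is an inclusion-reversing involution of the family of convex
    sets. A maximal convex K with K ⊆ N[K] satisfies K = N[K], since otherwise
    one could add to K a vertex of N[K]; applying N to one-vertex-step chains
    from ∅ to K and from K to V then gives |V| = 2|K|, so |V| is even. Hence, in
    odd order, there is a star; every nonempty convex set contains all stars and
    some singleton is convex, so the star s is unique. For a unique star s,
    K ↦ K \ {s} is a bijection from the nonempty convex sets of G to the convex
    sets of G - s, which transports the geometry in both directions. *)

(** * The Galois connection of [common_cnbh] and one-vertex steps between convex sets *)

Section Convexity.
Variable G : sgraph.
Implicit Types (x y : G) (A B K X Y : {set G}).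

Lemma cnbh_refl x : x \in cnbh x.
Proof. exact: setU11. Qed.

Lemma cnbh_sym x y : (x \in cnbh y) = (y \in cnbh x).
Proof. by rewrite !inE eq_sym edge_sym. Qed.

Lemma common_cnbhP Y x :
  reflect {in Y, forall y, x \in cnbh y} (x \in common_cnbh Y).
Proof. exact: bigcapP. Qed.

Lemma common_cnbhS A B : A \subset B -> common_cnbh B \subset common_cnbh A.
Proof.
move=> sAB; apply/subsetP=> x /common_cnbhP xB.
by apply/common_cnbhP=> y /(subsetP sAB); apply: xB.
Qed.

Lemma common_cnbh_galois A B :
  (A \subset common_cnbh B) = (B \subset common_cnbh A).
Proof.
suff imp X Y : X \subset common_cnbh Y -> Y \subset common_cnbh X.
  by apply/idP/idP; apply: imp.
move=> /subsetP sXY; apply/subsetP=> y yY; apply/common_cnbhP=> x xX.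
by rewrite cnbh_sym; move/common_cnbhP: (sXY x xX); apply.
Qed.

Lemma common_cnbh3 Y :
  common_cnbh (common_cnbh (common_cnbh Y)) = common_cnbh Y.
Proof.
apply/eqP; rewrite eqEsubset [X in _ && X]common_cnbh_galois subxx andbT.
by apply: common_cnbhS; rewrite common_cnbh_galois.
Qed.

Lemma common_cnbh0 : common_cnbh set0 = [set: G].
Proof. by apply/setP=> x; rewrite inE; apply/common_cnbhP=> y; rewrite inE. Qed.

Lemma starP s : star s <-> s \in common_cnbh [set: G].
Proof.
split=> [Ns|/common_cnbhP sN].
  by apply/common_cnbhP=> y _; rewrite cnbh_sym Ns inE.
by apply/setP=> y; rewrite cnbh_sym sN inE.
Qed.

Lemma nconvex0 : set0 \in nconvex G.
Proof. exact: setU11. Qed.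

Lemma nconvex_common_cnbh Y : common_cnbh Y \in nconvex G.
Proof. by rewrite !inE imset_f ?orbT. Qed.

Lemma nconvexP K :
  reflect (K = set0 \/ exists Y, K = common_cnbh Y) (K \in nconvex G).
Proof.
apply: (iffP setU1P) => -[->|]; [by left | | by left | ].
  by case/imsetP=> Y _ ->; right; exists Y.
by case=> Y ->; right; apply: imset_f.
Qed.

(** N is decreasing, so every N[Y] contains N[V], the set of stars. *)
Lemma star_in_nconvex s K : star s -> K \in nconvex G -> K != set0 -> s \in K.
Proof.
move=> /starP sN /nconvexP[->|[Y ->] _]; first by rewrite eqxx.
by apply: subsetP sN; apply/common_cnbhS/subsetT.
Qed.

Lemma nhull_extreme_sub K : K \in nconvex G -> nhull (extreme K) \subset K.
Proof.
move=> cK; apply: bigcap_inf.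
by rewrite cK; apply/subsetP=> x /setIdP[].
Qed.

(** The hull of ex(B) is B exactly when no convex A contains ex(B) without containing B. This form
    needs no hulls and is easy to transport. *)
Lemma n_convex_geometryP :
  n_convex_geometry G <->
  {in nconvex G &, forall A B, ~~ (B \subset A) ->
     exists2 x, x \in B :\: A & B :\ x \in nconvex G}.
Proof.
split=> [cgG A B cA cB nsBA|drop K cK].
  case: (boolP (extreme B \subset A)) => [sEA|/subsetPn[x]].
    by case/negP: nsBA; rewrite (cgG B cB); apply: bigcap_inf; rewrite cA.
  by rewrite inE => /andP[xB cBx] xA; exists x => //; rewrite inE xA.
apply/eqP; rewrite eqEsubset nhull_extreme_sub // andbT.
apply/bigcapsP=> A /andP[cA sEA]; apply: contraT => nsKA.
have [x /setDP[xK xA] cKx] := drop A K cA cK nsKA.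
by case/negP: xA; apply: (subsetP sEA); rewrite inE xK.
Qed.

(** Extreme points of [B] outside [A] are deleted one at a time; the last one before reaching [A] is
    the vertex sought. *)
Lemma nconvex_extend A B : n_convex_geometry G ->
    A \in nconvex G -> B \in nconvex G -> A \proper B ->
  exists2 x, x \in B :\: A & x |: A \in nconvex G.
Proof.
move=> /n_convex_geometryP drop cA.
have [n leBn] := ubnP #|B|.
elim: n => // n IHn in B leBn * => cB /andP[sAB nsBA].
have [x xBA cBx] := drop A B cA cB nsBA; have [xB xA] := setDP xBA.
have sABx : A \subset B :\ x by rewrite subsetD1 sAB.
have [eqA|neqA] := eqVneq A (B :\ x).
  by exists x => //; rewrite eqA setD1K.
have ltBx : #|B :\ x| < n by rewrite (cardsD1 x) xB in leBn.
have ABx : A \proper B :\ x by rewrite properEneq neqA.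
have [y yBA cy] := IHn _ ltBx cBx ABx; exists y => //.
by apply: subsetP yBA; rewrite setSD ?subsetDl.
Qed.

(** * Parity in the absence of a star *)

Section NoStar.
Hypotheses (cgG : n_convex_geometry G) (noStar : forall s : G, ~ star s).

Lemma common_cnbhT : common_cnbh [set: G] = set0.
Proof. by apply/setP=> s; rewrite inE; apply/negP=> /starP/noStar. Qed.

(** Without a star, N[V] is empty, so even the empty convex set is a value of N. *)
Lemma common_cnbhK : {in nconvex G, forall K, common_cnbh (common_cnbh K) = K}.
Proof.
move=> K /nconvexP[->|[Y ->]]; last exact: common_cnbh3.
by rewrite common_cnbh0 common_cnbhT.
Qed.

Lemma card_common_cnbh A B : A \in nconvex G -> B \in nconvex G ->
  A \subset B -> #|B| + #|common_cnbh B| <= #|A| + #|common_cnbh A|.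
Proof.
have [n] := ubnP #|B :\: A|.
elim: n => // n IHn in A * => leBAn cA cB sAB.
have [->//|neqAB] := eqVneq A B.
have AB : A \proper B by rewrite properEneq neqAB.
have [x xBA cAx] := nconvex_extend _ _ cgG cA cB AB; have [xB xA] := setDP xBA.
have ltBAx : #|B :\: (x |: A)| < n.
  by rewrite setUC -setDDl; rewrite (cardsD1 x) xBA in leBAn.
apply: leq_trans (IHn _ ltBAx cAx cB _) _; first by rewrite subUset sub1set xB.
(* Adding [x] gains one vertex, and N must lose at least one: otherwise the Galois connection puts
   [x] in N[N[A]] = A. *)
rewrite cardsU1 xA add1n addSnnS leq_add2l; apply: proper_card.
rewrite properE common_cnbhS ?subsetUr //=; apply: contra xA => sN.
rewrite -(common_cnbhK _ cA); apply: subsetP (setU11 x A).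
by rewrite common_cnbh_galois.
Qed.

Lemma odd_card_no_star : ~~ odd #|G|.
Proof.
pose P K := (K \in nconvex G) && (K \subset common_cnbh K).
have P0 : P set0 by rewrite /P nconvex0 sub0set.
have [K /maxsetP[/andP[cK sKN] maxK] _] := maxset_exists P0.
have eqK : common_cnbh K = K.
  apply: contraTeq isT => neqK.
  have KN : K \proper common_cnbh K by rewrite properEneq eq_sym neqK.
  have [x /setDP[xN xK] cKx] :=
    nconvex_extend _ _ cgG cK (nconvex_common_cnbh K) KN.
  (* [P] says that the convex set is a clique; a vertex of N[K] is adjacent to all the rest of K, so
     adding it keeps a clique. *)
  have PKx : P (x |: K).
    rewrite /P cKx; apply/subsetP=> y yKx; apply/common_cnbhP=> z.
    have sKxN : {in x |: K, forall t, t \in common_cnbh K}.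
      by move=> t /setU1P[->|/(subsetP sKN)].
    case/setU1P=> [->|zK]; last by move/common_cnbhP: (sKxN y yKx); apply.
    case/setU1P: yKx => [->|yK]; first exact: cnbh_refl.
    by rewrite cnbh_sym; move/common_cnbhP: xN; apply.
  by case/negP: xK; rewrite -(maxK _ PKx (subsetUr _ _)) setU11.
have cT : [set: G] \in nconvex G by rewrite -common_cnbh0 nconvex_common_cnbh.
(* The two instances give 2|K| ≤ |V| and |V| ≤ 2|K|. *)
have := card_common_cnbh _ _ nconvex0 cK (sub0set K).
have := card_common_cnbh _ _ cK cT (subsetT K).
rewrite eqK common_cnbh0 common_cnbhT cards0 addn0 add0n cardsT => le1 le2.
have -> : #|G| = #|K| + #|K| by apply/eqP; rewrite eqn_leq le1.
by rewrite addnn odd_double.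
Qed.

End NoStar.

(** One step from the empty set towards V yields a convex singleton, which contains every star. *)
Lemma star_unique (s t : G) : n_convex_geometry G -> star s -> star t -> s = t.
Proof.
move=> cgG ss st.
have cT : [set: G] \in nconvex G by rewrite -common_cnbh0 nconvex_common_cnbh.
have pT : set0 \proper [set: G] by rewrite proper0; apply/set0Pn; exists s.
have [x _ cx] := nconvex_extend _ _ cgG nconvex0 cT pT.
have nx : x |: set0 != set0 by apply/set0Pn; exists x; apply: setU11.
move: (star_in_nconvex _ _ ss cx nx) (star_in_nconvex _ _ st cx nx).
by rewrite setU0 => /set1P-> /set1P->.
Qed.

End Convexity.

(** * Deleting the unique star *)

Section DeleteStar.
Variables (G : sgraph) (s : G).
Hypothesis s_unique : unique (@star G) s.

Let H := del_vertex s.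
Let trace (K : {set G}) : {set H} := [set x | val x \in K].

Lemma del_vertex_cnbh (x y : H) : (val x \in cnbh (val y)) = (x \in cnbh y).
Proof. by rewrite !inE. Qed.

Lemma val_del_vertex (x : G) : x != s -> {x' : H | val x' = x}.
Proof.
move=> xs; have xP : x \in [set~ s] by rewrite !inE.
by exists (Sub x xP).
Qed.

Lemma nconvex_del_vertex (K : {set G}) :
  s \in K -> (trace K \in nconvex H) = (K \in nconvex G).
Proof.
have [ss s_only] := s_unique.
move=> sK; apply/nconvexP/nconvexP=> [[tK0|[Y tKY]]|[K0|[Y KY]]]; right.
(* An empty trace means K = {s}, which is N[V] because [s] is the only star. *)
- exists [set: G]; apply/setP=> x; apply/idP/idP=> [xK|/starP/s_only <- //].
  have [->|xs] := eqVneq x s; first exact/starP.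
  have [x' ex'] := val_del_vertex _ xs.
  by move/setP/(_ x'): tK0; rewrite !inE ex' xK.
- exists [set val y | y in Y]; apply/setP=> x.
  have [->|xs] := eqVneq x s.
    by rewrite sK; apply/esym; apply/common_cnbhP=> y _; rewrite cnbh_sym ss inE.
  have [x' <-] := val_del_vertex _ xs.
  have -> : (val x' \in K) = (x' \in trace K) by rewrite inE.
  rewrite tKY; apply/common_cnbhP/common_cnbhP=> xY y.
    by case/imsetP=> z zY ->; rewrite del_vertex_cnbh xY.
  by move=> yY; rewrite -del_vertex_cnbh xY ?imset_f.
- by rewrite K0 inE in sK.
(* Membership of [s] in Y imposes no condition, since N[s] = V. *)
exists (trace Y); apply/setP=> x; rewrite inE KY.
apply/common_cnbhP/common_cnbhP=> xY y yY.
  by rewrite -del_vertex_cnbh xY //; rewrite inE in yY.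
have [->|ys] := eqVneq y s; first by rewrite ss inE.
have [y' ey'] := val_del_vertex _ ys.
by rewrite -ey' del_vertex_cnbh xY // inE ey'.
Qed.

Lemma traceU1_imset (K : {set H}) : trace (s |: [set val x | x in K]) = K.
Proof.
apply/setP=> x; rewrite !inE (mem_imset _ _ val_inj).
by have := valP x; rewrite !inE => /negPf->.
Qed.

Lemma traceD1 (K : {set G}) (x : H) : trace (K :\ val x) = trace K :\ x.
Proof. by apply/setP=> y; rewrite !inE. Qed.

Lemma val_neq_del (x : H) : val x != s.
Proof. by have := valP x; rewrite !inE. Qed.

Lemma n_convex_geometry_del_vertex : n_convex_geometry G <-> n_convex_geometry H.
Proof.
have [ss _] := s_unique.
split=> /n_convex_geometryP drop; apply/n_convex_geometryP=> A B cA cB nsBA.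
  pose lift (K : {set H}) := s |: [set val x | x in K].
  have cl K : K \in nconvex H -> lift K \in nconvex G.
    by rewrite -nconvex_del_vertex ?setU11 ?traceU1_imset.
  have [|x xBA cBx] := drop (lift A) (lift B) (cl _ cA) (cl _ cB).
    have [x xB xA] := subsetPn nsBA; apply/subsetPn; exists (val x).
      by rewrite setU1r ?imset_f.
    by rewrite !inE negb_or val_neq_del (mem_imset _ _ val_inj).
  have [xB xA] := setDP xBA.
  (* Both lifts contain [s], so the vertex dropped survives in [H]. *)
  have xs : x != s by apply: contraNneq xA => ->; apply: setU11.
  have [x' ex'] := val_del_vertex _ xs; exists x'.
    have inl (K : {set H}) : (x' \in K) = (x \in lift K).
      by rewrite -{1}[K]traceU1_imset inE ex'.
    by rewrite in_setD !inl xA.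
  rewrite -[B]traceU1_imset -traceD1 nconvex_del_vertex ?ex' //.
  by rewrite !inE eq_sym xs eqxx.
have sB : s \in B.
  apply: star_in_nconvex => //.
  by apply: contraNneq nsBA => ->; apply: sub0set.
have cBt : trace B \in nconvex H by rewrite nconvex_del_vertex.
have cAt : trace A \in nconvex H.
  have [A0|A0] := eqVneq A set0; last first.
    by rewrite nconvex_del_vertex ?(star_in_nconvex _ s).
  suff -> : trace A = set0 by apply: nconvex0.
  by apply/setP=> x; rewrite !inE A0 inE.
have [sBAt|nsBAt] := boolP (trace B \subset trace A).
  have sBA x : x \in B -> x != s -> x \in A.
    move=> xB xs; have [x' ex'] := val_del_vertex _ xs.
    by have /(subsetP sBAt) : x' \in trace B; rewrite inE ex'.
  have sA : s \notin A.
    have [x xB xA] := subsetPn nsBA; suff <- : x = s by [].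
    by apply: contraNeq xA; apply: sBA.
  have A0 : A = set0 by apply: contraNeq sA; apply: star_in_nconvex.
  exists s; first by rewrite inE sA.
  suff -> : B :\ s = set0 by apply: nconvex0.
  apply/setP=> x; rewrite !inE; apply/negP=> /andP[xs xB].
  by have := sBA x xB xs; rewrite A0 inE.
have [x xBA cBx] := drop _ _ cAt cBt nsBAt; exists (val x).
  by move: xBA; rewrite !inE.
rewrite -nconvex_del_vertex ?traceD1 //.
by rewrite !inE sB eq_sym val_neq_del.
Qed.

End DeleteStar.

Theorem proposition39 (G : sgraph) (Godd : odd #|G|) :
  n_convex_geometry G <->
  exists s : G, unique (@star G) s /\ n_convex_geometry (del_vertex s).
Proof.
split=> [cgG|[s [us]]]; last by move/(n_convex_geometry_del_vertex _ _ us).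
case: (pickP (mem (common_cnbh [set: G]))) => [s /starP ss|noStar].
  have us : unique (@star G) s.
    by split=> // t; apply: star_unique.
  by exists s; split=> //; apply/(n_convex_geometry_del_vertex _ _ us).
suff /negP[] : ~~ odd #|G| by [].
by apply: odd_card_no_star cgG _ => s /starP; apply/negP; rewrite [_ \in _]noStar.
Qed.
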